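(* Let $M$ be a matroid with ground set $E$ and rank function $r$, and let $k>0$ be an integer. The following are equivalent: (i) $M$ has tree-width at least $k$; (ii) $M$ has no $S_k$-tree over $\mathcal F_k$; (iii) $M$ has an $\mathcal F_k$-tangle of $S_k$.
   Context: $\lambda(X)=r(X)+r(E\setminus X)-r(M)$. $\vec U$ is the set of ordered bipartitions $(X,Y)$ of $E$ (parts may be empty), ordered by $(A,B)\le(C,D)$ iff $A\subseteq C$, $B\supseteq D$, inverse $(B,A)$; $\{A,B\}$ is the unoriented separation; $\mathrm{ord}(X,Y)=\lambda(X)$; $\vec S_k=\{(A,B)\in\vec U:\mathrm{ord}(A,B)<k\}$, $S_k$ the unoriented ones. An orientation of $S_k$ is a set $O\subseteq\vec S_k$ containing exactly one of $(A,B),(B,A)$ for each $\{A,B\}\in S_k$; it is consistent if there are no $(A,B),(C,D)\in\vec S_k$ with $\{A,B\}\ne\{C,D\}$, $(A,B)<(C,D)$, $(B,A)\in O$, $(C,D)\in O$. A star is a set $\sigma$ with $(A,B)\ne(B,A)$ for each element and $(A,B)\le(D,C)$ for distinct $(A,B),(C,D)\in\sigma$. For a star $\sigma=\{(A_i,B_i):i=0,\dots,n\}$, $\langle\sigma\rangle=r(M)+\sum_{i=0}^n(r(B_i)-r(M))$; $\mathcal F_k$ is the set of stars $\sigma\subseteq\vec U$ with $\langle\sigma\rangle<k$. An $\mathcal F_k$-tangle of $S_k$ is a consistent orientation of $S_k$ with no subset in $\mathcal F_k$. An $S_k$-tree over $\mathcal F_k$ is a pair $(T,\alpha)$, $T$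 a finite tree with at least one node, $\alpha$ assigning to each ordered pair $(x,y)$ with $xy\in E(T)$ an element $\alpha(x,y)\in\vec S_k$ with $\alpha(y,x)$ the inverse of $\alpha(x,y)$ and $\{\alpha(x,t):xt\in E(T)\}\in\mathcal F_k$ for every node $t$. A tree-decomposition of $M$ is a pair $(T,\tau)$ with $T$ a tree and $\tau\colon E\to V(T)$; for a node $t$ with components $T_1,\dots,T_d$ of $T-t$ and $F_i=\tau^{-1}(V(T_i))$, the width of $t$ is $\sum_{i=1}^dr(E\setminus F_i)-(d-1)r(M)$ (and $r(M)$ if $T$ has one node); the width of $(T,\tau)$ is the maximum node width and the tree-width of $M$ is the minimum width of a tree-decomposition. *)

(* Defs.v *)
From mathcomp Require Import all_boot all_order all_algebra.
Set Implicit Arguments.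
Unset Strict Implicit.
Unset Printing Implicit Defensive.
Import Order.TTheory GRing.Theory Num.Theory.
Local Open Scope ring_scope.

(** * Matroids *)

(** The whole finite type [E] is the ground set. *)
Record matroid (E : finType) := Matroid {
  indep : {set {set E}};
  indep0 : set0 \in indep;
  indepS : forall I J : {set E}, J \in indep -> I \subset J -> I \in indep;
  indep_aug : forall I J : {set E},
    I \in indep -> J \in indep -> (#|I| < #|J|)%N ->
    exists2 x, x \in J :\: I & x |: I \in indep
}.

(** Integer-valued, so that the subtractions below are not truncated. *)
Definition rank (E : finType) (M : matroid E) (X : {set E}) : int :=
  (\max_(I in indep M | I \subset X) #|I|)%N%:Z.

Definition mrank (E : finType) (M : matroid E) : int := rank M [set: E].

Definition connectivity (E : finType) (M : matroid E) (X : {set E}) : int :=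
  rank M X + rank M (~: X) - mrank M.

(** * Separations *)

(** A separation is a pair of sets lying in [bipartitions E]. *)
Notation sep E := ({set E} * {set E})%type.

Definition bipartitions (E : finType) : {set sep E} :=
  [set s : sep E | (s.1 :|: s.2 == [set: E]) && (s.1 :&: s.2 == set0)].

Definition sep_inv (E : finType) (s : sep E) : sep E := (s.2, s.1).

Definition sep_le (E : finType) (s t : sep E) : bool :=
  (s.1 \subset t.1) && (t.2 \subset s.2).

Definition sep_lt (E : finType) (s t : sep E) : bool :=
  (s != t) && sep_le s t.

Definition unoriented (E : finType) (s : sep E) : {set {set E}} :=
  [set s.1; s.2].

Definition sep_order (E : finType) (M : matroid E) (s : sep E) : int :=
  connectivity M s.1.

Definition seps_below (E : finType) (M : matroid E) (k : int) : {set sep E} :=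
  [set s in bipartitions E | sep_order M s < k].

(** * Stars *)

Definition star (E : finType) (sigma : {set sep E}) : Prop :=
  (forall s, s \in sigma -> s <> sep_inv s) /\
  (forall s t, s \in sigma -> t \in sigma -> s <> t -> sep_le s (sep_inv t)).

Definition star_order (E : finType) (M : matroid E) (sigma : {set sep E}) : int :=
  mrank M + \sum_(s in sigma) (rank M s.2 - mrank M).

(** The empty star is admitted; its order is the rank of the matroid. *)
Definition small_star (E : finType) (M : matroid E) (k : int)
    (sigma : {set sep E}) : Prop :=
  [/\ sigma \subset bipartitions E, star sigma & star_order M sigma < k].

(** * Tangles *)

(** Counting makes sense also of the degenerate separation [(set0, set0)] of an
    empty ground set, which is its own inverse. *)
Definition orientation (E : finType) (M : matroid E) (k : int)
    (O : {set sep E}) : Prop :=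
  O \subset seps_below M k /\
  (forall s, s \in seps_below M k -> #|O :&: [set s; sep_inv s]| = 1%N).

Definition consistent (E : finType) (M : matroid E) (k : int)
    (O : {set sep E}) : Prop :=
  ~ exists s t : sep E,
      [/\ s \in seps_below M k, t \in seps_below M k &
          [/\ unoriented s <> unoriented t, sep_lt s t,
              sep_inv s \in O & t \in O]].

Definition tangle (E : finType) (M : matroid E) (k : int)
    (O : {set sep E}) : Prop :=
  [/\ orientation M k O, consistent M k O &
      forall sigma : {set sep E}, sigma \subset O -> ~ small_star M k sigma].

(** * Trees *)

(** For a symmetric relation, [ucycle] also holds of [[:: x; y]] when [x] and
    [y] are adjacent; graph cycles are those with at least three nodes. *)
Record tree := Tree {
  node :> finType;
  adj : rel node;
  adj_sym : symmetric adj;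
  adj_irr : irreflexive adj;
  tree_nonempty : (0 < #|node|)%N;
  tree_connected : forall x y, connect adj x y;
  tree_acyclic : forall c : seq node, ucycle adj c -> (size c < 3)%N
}.

(** Only the values of [alpha] on adjacent pairs matter. *)
Definition separation_tree (E : finType) (M : matroid E) (k : int)
    (T : tree) (alpha : T -> T -> sep E) : Prop :=
  [/\ forall x y, adj x y -> alpha x y \in seps_below M k,
      forall x y, adj x y -> alpha y x = sep_inv (alpha x y) &
      forall t, small_star M k [set alpha x t | x in [pred x | adj x t]]].

(** * Tree-decompositions *)

Definition adj_minus (T : tree) (t : T) : rel T :=
  [rel x y | [&& adj x y, x != t & y != t]].

(** The node sets of the components of [T - t]. *)
Definition components (T : tree) (t : T) : {set {set T}} :=
  equivalence_partition (connect (adj_minus t)) [set~ t].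

(** If [T] has one node, there are no components and this is [mrank M]. *)
Definition node_width (E : finType) (M : matroid E) (T : tree) (tau : E -> T)
    (t : T) : int :=
  \sum_(C in components t) rank M (~: (tau @^-1: C))
  - (#|components t|%:Z - 1) * mrank M.

(** [w] is the maximum of the node widths. *)
Definition is_width (E : finType) (M : matroid E) (T : tree) (tau : E -> T)
    (w : int) : Prop :=
  (exists t, node_width M tau t = w) /\ (forall t, node_width M tau t <= w).

(** [w] is the minimum of the widths of tree-decompositions. *)
Definition is_tree_width (E : finType) (M : matroid E) (w : int) : Prop :=
  (exists (T : tree) (tau : E -> T), is_width M tau w) /\
  (forall (T : tree) (tau : E -> T) (w' : int), is_width M tau w' -> w <= w').

(* Main.v *)
Require Import Defs.
From mathcomp Require Import all_boot all_order all_algebra.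
From mathcomp Require Import zify.
From Stdlib Require Import Classical ClassicalEpsilon.
Set Implicit Arguments.
Unset Strict Implicit.
Unset Printing Implicit Defensive.
Import Order.TTheory GRing.Theory Num.Theory.
Local Open Scope ring_scope.

(** A separation is determined by its first side [A], and a star by a sequence
    of pairwise disjoint sets.  Call [A] derivable from a family [P] of sides
    if a rooted tree of stars in [F_k], with leaves in [P], has [(A, ~: A)] on
    its root edge.  If [setT] is derivable from nothing, then sending every
    ground element to the deepest node whose side contains it gives a
    tree-decomposition of width less than [k]; conversely, such a
    tree-decomposition is an [S_k]-tree by means of the sets that its edges
    induce, and an [S_k]-tree is a derivation, read from the leaves.

    If [setT] is not derivable, extend the empty family to a maximal down-closed
    [P] from which it is still not derivable.  If [P] decided neither
    orientation of some separation, turning derivations around would produce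
    [A] contained in [B], of small connectivity, with [~: A] and [B] derivable.  Take [X]
    of least connectivity between [A] and [B].  By submodularity, intersecting
    the first derivation with [~: X] and the second one with [X] keeps all stars
    in [F_k], so [~: X] and [X] are both derivable, and hence so is [setT], a
    contradiction.  Thus [P] is a tangle.  Finally, a tangle and an [S_k]-tree
    exclude each other: by induction from the leaves, the tangle would contain
    all separations of the tree, and hence the star at each node. *)

(** * Matroid rank and stars *)

Section Rank.
Variables (E : finType) (M : matroid E).
Implicit Types A B C I U W X Y Z : {set E}.

Lemma rank_basis X :
  exists I : {set E}, [/\ I \in indep M, I \subset X & rank M X = #|I|%:Z].
Proof.
have h0 : (0 < #|[pred I in indep M | I \subset X]|)%N.
  by apply/card_gt0P; exists set0; rewrite inE indep0 sub0set.
have [I /andP[hI hX] e] := eq_bigmax_cond (fun I : {set E} => #|I|) h0.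
by exists I; split=> //; rewrite /rank -e.
Qed.

Lemma rank_ge I X : I \in indep M -> I \subset X -> #|I|%:Z <= rank M X.
Proof.
move=> hI hX; rewrite lez_nat.
by apply: (@leq_bigmax_cond _ [pred I | (I \in indep M) && (I \subset X)]
  (fun I : {set E} => #|I|)); rewrite /= hI.
Qed.

Lemma rankS X Y : X \subset Y -> rank M X <= rank M Y.
Proof.
move=> sXY; have [I [hI hX ->]] := rank_basis X.
exact/rank_ge/(subset_trans hX).
Qed.

Lemma rank0 : rank M set0 = 0.
Proof.
by have [I [_ + ->]] := rank_basis set0; rewrite subset0 => /eqP->; rewrite cards0.
Qed.

Lemma basis_extension I X : I \in indep M -> I \subset X ->
  exists J : {set E},
    [/\ J \in indep M, I \subset J, J \subset X & rank M X = #|J|%:Z].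
Proof.
have [K [hK hKX eK]] := rank_basis X.
have [n] := ubnP (#|K| - #|I|)%N; elim: n I => // n IHn I lt_n hI hIX.
have [lt_IK|le_KI] := ltnP #|I| #|K|; last first.
  by exists I; split=> //; apply/eqP; rewrite eq_le rank_ge // andbT eK lez_nat.
have [x /setDP[xK xI] hxI] := indep_aug hI hK lt_IK.
have [||J [hJ + hJX eJ]] := IHn (x |: I) _ hxI.
- by rewrite cardsU1 xI; lia.
- by rewrite subUset sub1set (subsetP hKX).
by rewrite subUset => /andP[_ ?]; exists J.
Qed.

(** Extend a basis of [A :&: B] to one of [A :|: B]; its traces on [A] and [B] are independent, and
    inclusion-exclusion compares their sizes. *)
Lemma rank_submod A B :
  rank M (A :|: B) + rank M (A :&: B) <= rank M A + rank M B.
Proof.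
have [I [hI sI eI]] := rank_basis (A :&: B).
have sIU : I \subset A :|: B.
  by apply: subset_trans sI (subset_trans (subsetIl _ _) (subsetUl _ _)).
have [J [hJ sIJ sJ ->]] := basis_extension hI sIU; rewrite eI.
have sub C : #|J :&: C|%:Z <= rank M C.
  by apply: rank_ge (subsetIr _ _); apply: indepS hJ (subsetIl _ _).
apply: le_trans (lerD (sub A) (sub B)).
have := cardsUI (J :&: A) (J :&: B); rewrite -setIUr (setIidPl sJ) -setIIr => e.
have : (#|I| <= #|J :&: (A :&: B)|)%N by rewrite subset_leq_card // subsetI sIJ.
lia.
Qed.

Lemma connectivityC A : connectivity M (~: A) = connectivity M A.
Proof. by rewrite /connectivity setCK; lia. Qed.

Lemma connectivity_submod A B :
  connectivity M (A :|: B) + connectivity M (A :&: B)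
    <= connectivity M A + connectivity M B.
Proof.
have h1 := rank_submod A B; have h2 := rank_submod (~: A) (~: B).
by rewrite /connectivity setCU setCI; lia.
Qed.

(** * Disjoint families and the order of their stars *)

Definition pairwise_disjoint (l : seq {set E}) : Prop :=
  forall e, (count (fun A : {set E} => e \in A) l <= 1)%N.

Lemma pairwise_disjoint_cons A l : pairwise_disjoint (A :: l) ->
  pairwise_disjoint l /\ forall B, B \in l -> B \subset ~: A.
Proof.
move=> dl; split=> [e|B Bl]; first by apply: leq_trans (dl e); rewrite /= leq_addl.
apply/subsetP=> e eB; rewrite inE; apply/negP=> eA; have := dl e; rewrite /= eA.
have: has (fun A : {set E} => e \in A) l by apply/hasP; exists B.
by rewrite has_count; lia.
Qed.

Variable k : int.

(** The star of the separations [(A, ~: A)], with [A] in [l]; as a sequence, so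
    that the empty set may be repeated. *)
Definition small (l : seq {set E}) : Prop :=
  pairwise_disjoint l /\
  mrank M + \sum_(A <- l) (rank M (~: A) - mrank M) < k.

Lemma small_perm l l' : perm_eq l l' -> small l -> small l'.
Proof.
move=> p [h1 h2]; split=> [e|]; last by rewrite -(perm_big _ p).
by have /permP<- := p.
Qed.

Lemma small_cons0 l : small (set0 :: l) <-> small l.
Proof.
rewrite /small big_cons setC0 /mrank subrr add0r.
by split=> -[h1 h2]; split=> // e; have := h1 e; rewrite /= inE.
Qed.

Lemma small_setT : 0 < k -> small [:: [set: E]].
Proof.
move=> k_gt0; split=> [e|]; first by rewrite /= inE.
by rewrite big_seq1 setCT rank0; lia.
Qed.

Lemma small_pair A : connectivity M A < k -> small [:: A; ~: A].
Proof.
move=> h; split=> [e|]; first by rewrite /= !inE; case: (e \in A).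
by rewrite big_cons big_seq1 setCK; move: h; rewrite /connectivity; lia.
Qed.

(* Marginal ranks of disjoint sets add up to at most the marginal of the union. *)
Lemma rank_marginals W U l :
    pairwise_disjoint l -> (forall A, A \in l -> A \subset U) ->
  \sum_(A <- l) (rank M W - rank M (W :\: A)) <= rank M W - rank M (W :\: U).
Proof.
elim: l U => [|A l IHl] U.
  by rewrite big_nil subr_ge0 rankS // subsetDl.
move=> /pairwise_disjoint_cons[dl sA] sU.
have sU' B : B \in l -> B \subset U :\: A.
  by move=> Bl; rewrite setDE subsetI sA // sU // inE Bl orbT //.
have := IHl _ dl sU'; rewrite big_cons.
have := rank_submod (W :\: A) (W :\: (U :\: A)).
have /setUidPr UA : A \subset U by rewrite sU ?mem_head.
have -> : (W :\: A) :|: (W :\: (U :\: A)) = W.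
  by apply/setP=> e; rewrite !inE;
     case: (e \in W); case: (e \in A); case: (e \in U).
have -> : (W :\: A) :&: (W :\: (U :\: A)) = W :\: U.
  by rewrite -{2}UA; apply/setP=> e; rewrite !inE;
     case: (e \in W); case: (e \in A); case: (e \in U).
by set c := (\sum_(_ <- _) _); move: c => c; lia.
Qed.

(** By submodularity, cutting [B] down to [B :&: Z] raises its term by at most the marginal rank of
    [B] in [~: Z]. These marginals add up to at most [r(~: Z) - r(~: Y)], and the root term changes
    by [r(Z) - r(Y)], so the order grows by at most the connectivity of [Z] minus that of [Y]. *)
Lemma small_shift Y Z l : Z \subset Y -> connectivity M Z <= connectivity M Y ->
  small (~: Y :: l) -> small (~: Z :: [seq B :&: Z | B <- l]).
Proof.
move=> sZY leZY [/pairwise_disjoint_cons[dl sY] sl].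
split=> [e|].
  rewrite /= count_map inE; have [eZ|eZ] := boolP (e \in Z) => /=.
    by apply: leq_trans (dl e); rewrite add0n; apply: sub_count => B /=;
       rewrite inE => /andP[].
  by rewrite (eq_count (a2 := pred0)) ?count_pred0 // => B /=;
     rewrite inE (negPf eZ) andbF.
move: sl; rewrite !big_cons big_map !setCK.
rewrite setCK in sY; have := rank_marginals (~: Z) dl sY.
have -> : ~: Z :\: Y = ~: Y by rewrite setDE -setCU (setUidPr sZY).
have : \sum_(B <- l) (rank M (~: (B :&: Z)) - mrank M) <=
   \sum_(B <- l) (rank M (~: B) - mrank M) +
   \sum_(B <- l) (rank M (~: Z) - rank M (~: Z :\: B)).
  rewrite -big_split /=; apply: ler_sum => B _.
  have := rank_submod (~: B) (~: Z).
  by rewrite -setCI -setCU setDE -setCU setUC; lia.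
move: leZY; rewrite /connectivity.
set s1 := (\sum_(_ <- _) _); set s2 := (\sum_(_ <- _) _).
set s3 := (\sum_(_ <- _) _); move: s1 s2 s3; lia.
Qed.

(* With [W = setT], [rank_marginals] bounds [rank M A] by the contribution of the
   other members of the star. *)
Lemma small_connectivity l A : small l -> A \in l -> connectivity M A < k.
Proof.
move=> sl Al; have [] := small_perm (perm_to_rem Al) sl.
move=> /pairwise_disjoint_cons[dl sA]; rewrite big_cons => hs.
have := rank_marginals setT dl sA.
rewrite setTD setCK => h; apply: le_lt_trans hs.
have e : \sum_(B <- rem A l) (rank M (~: B) - mrank M) =
  - \sum_(B <- rem A l) (rank M setT - rank M (setT :\: B)).
  by rewrite -sumrN; apply: eq_bigr => B _; rewrite setTD /mrank; lia.
rewrite e /connectivity; move: h; rewrite /mrank.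
by set s := (\sum_(_ <- _) _); move: s; lia.
Qed.

End Rank.

(** * Derivations and tangles *)

Section Derivation.
Variables (E : finType) (M : matroid E) (k : int).
Hypothesis k_gt0 : 0 < k.
Implicit Types (A B X Y Z : {set E}) (P Q : {set {set E}}) (l : seq {set E}).

(** [A] stands for [(A, ~: A)], so the star [~: A :: l] consists of the inverse of
    [(A, ~: A)] and of separations derived before. *)
Inductive derivable P : {set E} -> Prop :=
| derivable_mem A : A \in P -> derivable P A
| derivable_star A l : small M k (~: A :: l) ->
    (forall B, B \in l -> derivable P B) -> derivable P A.

(** At the root the inverse separation has the empty side [~: setT], which adds nothing to the
    star. *)
Lemma derivable_small P l :
  small M k l -> (forall B, B \in l -> derivable P B) -> derivable P setT.
Proof. by move=> sl; apply: derivable_star; rewrite setCT; apply/small_cons0. Qed.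

(** The star with the single side [setT] has order 0, so [0 < k] makes it small. *)
Lemma derivable0 P : derivable P set0.
Proof. by apply: (@derivable_star P set0 [::]); rewrite // setC0; apply: small_setT. Qed.

Lemma derivable_cut P Q A :
  (forall B, B \in P -> derivable Q B) -> derivable P A -> derivable Q A.
Proof.
move=> PQ; elim=> {A} [A /PQ //|A l sl _ IH]; exact: derivable_star sl IH.
Qed.

Lemma derivable_compl P A : connectivity M A < k ->
  derivable P A -> derivable P (~: A) -> derivable P setT.
Proof.
move=> ltA dA dA'; apply: derivable_small (small_pair ltA) _ => B.
by rewrite !inE => /orP[]/eqP->.
Qed.

(** Down-closure is what will make the orientation consistent. *)
Definition down_closed P : Prop :=
  (forall A, A \in P -> connectivity M A < k) /\
  (forall A B, B \in P -> A \subset B -> connectivity M A < k -> A \in P).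

(** All sides in the part of the derivation that is visited lie in [Y], so each star can be shifted
    by the hypothesis; leaves stay in [P] by down-closure. *)
Lemma derivable_shift P Y Z : down_closed P ->
  (forall B, B \subset Y -> connectivity M (B :&: Z) <= connectivity M B) ->
  derivable P Y -> derivable P (Y :&: Z).
Proof.
move=> [ltP dP] leZ dY; elim: dY leZ => {Y} [A AP|A l sl _ IH] leZ.
  have leA := leZ A (subxx A).
  apply: derivable_mem; apply: dP (AP) (subsetIl _ _) _.
  exact: le_lt_trans leA (ltP _ AP).
have [/pairwise_disjoint_cons[_ +] _] := sl; rewrite setCK => sA.
apply: derivable_star (small_shift (subsetIl _ _) (leZ A (subxx A)) sl) _.
move=> _ /mapP[B Bl ->].
rewrite setIA (setIidPl (sA B Bl)); apply: IH => // C sC.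
exact/leZ/(subset_trans sC)/sA.
Qed.

(* Turning a derivation tree around, so that the leaf [S] becomes its root.
   As [S] is non-empty and the members of a star are disjoint, [S] is used at
   most once. *)
Lemma derivable_reroot P S A : S != set0 -> derivable (S |: P) A ->
  derivable P A \/ (S \subset A /\ derivable (~: A |: P) (~: S)).
Proof.
case/set0Pn=> e eS; elim=> {A} [A|A l sl _ IH].
  case/setU1P=> [->|AP]; last by left; apply: derivable_mem.
  by right; split=> //; apply: derivable_mem; rewrite setU11.
have [dl|] := classic (forall B, B \in l -> derivable P B).
  by left; apply: derivable_star sl dl.
move=> /not_all_ex_not[B /(imply_to_and (B \in l))[Bl ndB]]; right.
have [//|[sSB dB]] := IH B Bl.
have p : perm_eq (~: A :: l) (~: ~: B :: ~: A :: rem B l).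
  have := perm_to_rem Bl; rewrite -(perm_cons (~: A)) => /permPl ->.
  by rewrite setCK; apply/permPl=> C; rewrite (perm_catCA [:: _] [:: _]).
have sl' := small_perm p sl.
have [/pairwise_disjoint_cons[_ sA] _] := sl; rewrite setCK in sA.
have [/pairwise_disjoint_cons[_ sB] _] := sl'; rewrite setCK in sB.
split; first exact: subset_trans sSB (sA _ Bl).
apply: derivable_cut dB => C /setU1P[->|CP]; last first.
  by apply: derivable_mem; rewrite inE CP orbT.
apply: derivable_star sl' _ => D; rewrite inE => /predU1P[->|Dl].
  by apply: derivable_mem; rewrite setU11.
have [dD|[sSD _]] := IH D (mem_rem Dl).
  by apply: derivable_cut dD => F FP; apply: derivable_mem; rewrite inE FP orbT.
have /subsetP/(_ e (subsetP sSD e eS)) : D \subset ~: B.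
  by apply: sB; rewrite inE Dl orbT.
by rewrite inE (subsetP sSB).
Qed.

(** Rerooting at [S] leaves the old root [~: setT], the empty set, as a new leaf, and the empty set
    is derivable. An empty [S] can itself be cut out. *)
Lemma derivable_refute P S : derivable (S |: P) setT ->
  derivable P setT \/ derivable P (~: S).
Proof.
have cut0 A B : derivable P B -> derivable (B |: P) A -> derivable P A.
  by move=> dB; apply: derivable_cut => C /setU1P[->//|]; apply: derivable_mem.
have [->|nS] := eqVneq S set0; first by left; apply: cut0 (derivable0 P) _.
case/(derivable_reroot nS); [by left | case=> _; rewrite setCT => d; right].
exact: cut0 (derivable0 P) d.
Qed.

Lemma derivable_opposite P A B : down_closed P -> A \subset B ->
  connectivity M A < k -> derivable P (~: A) -> derivable P B ->
  derivable P setT.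
Proof.
move=> dP sAB ltA dA dB.
have [X /andP[sAX sXB] minX] :
    exists2 X : {set E}, (A \subset X) && (X \subset B) &
      forall Y : {set E}, (A \subset Y) && (Y \subset B) ->
        connectivity M X <= connectivity M Y.
  have h : [pred X : {set E} | (A \subset X) && (X \subset B)] A.
    by rewrite /= subxx.
  by case: (arg_minP (connectivity M) h) => X hX mX; exists X.
have ltX : connectivity M X < k.
  by apply: le_lt_trans ltA; apply: minX; rewrite subxx.
apply: (derivable_compl ltX).
  have -> : X = B :&: X by apply/esym/setIidPr.
  apply: derivable_shift dP _ dB => C sC.
  (* [C :|: X] still lies between [A] and [B], so its connectivity is at least that of [X], and
     submodularity passes the gain to [C :&: X]. *)
  have := connectivity_submod M C X; have := minX (C :|: X).
  rewrite subUset sC sXB (subset_trans sAX (subsetUr _ _)) => /(_ isT); lia.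
have -> : ~: X = ~: A :&: ~: X by apply/esym/setIidPr; rewrite setCS.
apply: derivable_shift dP _ dA => C sC.
(* The same argument after complementation: [~: (C :|: ~: X)] lies between [A] and [B]. *)
have := connectivity_submod M C (~: X); have := minX (~: (C :|: ~: X)).
rewrite !connectivityC setCU setCK subsetI sAX -setCS setCK sC.
rewrite (subset_trans (subsetIr _ _) sXB) => /(_ isT); lia.
Qed.

Lemma down_closed_extension P : down_closed P -> ~ derivable P setT ->
  exists Q, [/\ down_closed Q, ~ derivable Q setT &
    forall A, connectivity M A < k -> A \in Q \/ ~: A \in Q].
Proof.
have [n] := ubnP #|~: P|; elim: n P => // n IHn P ltn dP nd.
have [//|nex] := classic (exists Q, [/\ down_closed Q, ~ derivable Q setT &
    forall A, connectivity M A < k -> A \in Q \/ ~: A \in Q]).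
pose undecided A := [&& connectivity M A < k, A \notin P & ~: A \notin P].
(* A minimal undecided [S] below [A] can be added to [P] without losing down-closure. The larger
   family must derive [setT], or the induction would yield [Q]; hence [~: S] is derivable from
   [P]. *)
have refuted A : undecided A ->
    exists2 S, undecided S & S \subset A /\ derivable P (~: S).
  have [m] := ubnP #|A|; elim: m A => // m IHm A ltm uA.
  have [[B /andP[uB sBA]]|noB] := classic (exists B, undecided B && (B \proper A)).
    have [|S uS [sS dS]] := IHm B _ uB.
      by have := proper_card sBA; lia.
    by exists S => //; split=> //; apply: subset_trans sS (proper_sub sBA).
  exists A => //; split=> //.
  have /and3P[ltA AP A'P] := uA; case: (dP) => ltP closedP.
  have dAP : down_closed (A |: P).
    split=> [B /setU1P[->//|/ltP//]|B C CP sBC ltB].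
    have [eBA|nBA] := eqVneq B A; first by rewrite eBA setU11.
    rewrite inE; apply/orP; right.
    case/setU1P: CP sBC => [->|CP] sBC; last exact: closedP CP sBC ltB.
    (* A proper subset [B] outside [P] would be undecided too, since [~: B] in [P] would bring its
       subset [~: A] into [P]. *)
    apply/negPn/negP=> BP; apply: noB; exists B.
    rewrite properEneq nBA sBC /undecided ltB BP /= andbT.
    apply: contra A'P => B'P; apply: closedP B'P _ _; first by rewrite setCS.
    by rewrite connectivityC.
  have : derivable (A |: P) setT.
    apply: NNPP => /(IHn _ _ dAP) h; apply: nex; apply: h.
    have /proper_card : ~: (A |: P) \proper ~: P.
      rewrite properEneq setCS subsetUr andbT; apply: contra AP => /eqP/setC_inj<-.
      exact: setU11.
    by move=> h; apply: leq_trans h ltn.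
  by case/derivable_refute.
exists P; split=> // A ltA; apply: NNPP => nA.
have uA : undecided A.
  by rewrite /undecided ltA /=; apply/andP; split; apply/negP=> h; apply: nA; [left|right].
(* Refuting twice gives [S] and [U] with [S] contained in [~: U], and both [~: S] and [~: U]
   derivable. *)
have [S uS [_ dS]] := refuted A uA; have /and3P[ltS SP S'P] := uS.
have [|U uU [sU dU]] := refuted (~: S).
  by rewrite /undecided connectivityC setCK ltS SP S'P.
by apply: nd; apply: (derivable_opposite dP _ ltS dS dU); rewrite -setCS setCK.
Qed.

(** * Translation to separations, and the tangle *)

Lemma in_bipartitions (s : sep E) : (s \in bipartitions E) = (s.2 == ~: s.1).
Proof.
case: s => A B; rewrite inE /=; apply/andP/eqP => [[/eqP h1 /eqP h2]|->].
  apply/setP=> e; have := in_setT e; have := in_set0 e; rewrite -h1 -h2 !inE.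
  by case: (e \in A).
by rewrite setUCr setICr.
Qed.

Lemma sep_in_below A : ((A, ~: A) \in seps_below M k) = (connectivity M A < k).
Proof. by rewrite inE in_bipartitions eqxx. Qed.

Lemma small_of_star (sigma : {set sep E}) :
  small_star M k sigma -> small M k [seq s.1 | s <- enum sigma].
Proof.
move=> [bip [_ st] lt]; split; last first.
  rewrite big_map big_enum /=; apply: le_lt_trans lt.
  rewrite /star_order lerD2l; apply: ler_sum => s /(subsetP bip).
  by rewrite in_bipartitions => /eqP->.
move=> e; rewrite count_map -size_filter -(card_uniqP _); last first.
  by rewrite filter_uniq ?enum_uniq.
apply/card_le1_eqP => s t; rewrite !(mem_filter _ _ (enum sigma)) !mem_enum.
move=> /andP[/= es sS] /andP[/= et tS].
have [->//|nst] := eqVneq s t.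
have /andP[/subsetP/(_ e es)] := st _ _ sS tS (elimN eqP nst) => /=.
have := subsetP bip t tS; rewrite in_bipartitions => /eqP->.
by rewrite inE et.
Qed.

Lemma tangle_exists : ~ derivable set0 setT -> exists O, tangle M k O.
Proof.
have d0 : down_closed set0 by split=> [A|A B]; rewrite inE.
move=> /(down_closed_extension d0)[P [[ltP dP] ndP cP]].
have nboth A : A \in P -> ~: A \in P -> False.
  move=> AP A'P; apply/ndP/(derivable_compl (ltP _ AP)); exact: derivable_mem.
have inO (s : sep E) : s \in [set (A, ~: A) | A in P] = (s.1 \in P) && (s.2 == ~: s.1).
  apply/imsetP/andP => [[A AP ->]|[sP /eqP e]]; first by rewrite eqxx.
  by exists s.1 => //; rewrite -e; case: s {sP e}.
exists [set (A, ~: A) | A in P]; split.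
- split; first by apply/subsetP=> _ /imsetP[A /ltP ltA ->]; rewrite sep_in_below.
  move=> [A B]; rewrite inE in_bipartitions => /andP[/eqP/= -> ltA].
  have [AP|A'P] := cP A ltA.
    rewrite (_ : _ :&: _ = [set (A, ~: A)]) ?cards1 //; apply/setP=> s.
    rewrite in_setI inO !inE /sep_inv /=.
    have [->|_] := eqVneq s (A, ~: A); first by rewrite AP eqxx.
    have [->|_] := eqVneq s (~: A, A); last by rewrite andbF.
    by rewrite /=; case: (boolP (~: A \in P)) => // /(nboth _ AP).
  rewrite (_ : _ :&: _ = [set (~: A, A)]) ?cards1 //; apply/setP=> s.
  rewrite in_setI inO !inE /sep_inv /=.
  have [->|_] := eqVneq s (~: A, A); first by rewrite A'P setCK eqxx orbT.
  have [->|_] := eqVneq s (A, ~: A); last by rewrite andbF.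
  by rewrite /=; case: (boolP (A \in P)) => // /nboth /(_ A'P).
(* Down-closure puts [s.1], a subset of [t.1], into [P], next to its complement [s.2]. *)
- case=> s [t [sS tS [_ /andP[_ /andP[sst _]]]]].
  rewrite !inO /sep_inv /= => /andP[s2P /eqP es] /andP[t1P _].
  apply: (nboth s.2) => //; rewrite -es; apply: dP t1P sst _.
  by move: sS; rewrite inE => /andP[].
- move=> sigma sO sS; apply: ndP; apply: derivable_small (small_of_star sS) _.
  move=> _ /mapP[s + ->]; rewrite mem_enum => /(subsetP sO).
  by rewrite inO => /andP[sP _]; apply: derivable_mem.
Qed.

End Derivation.

(** * Trees and tree-decompositions *)

Section Branches.
Variable T : tree.
Implicit Types x y z t : T.

(** For adjacent [x] and [t], this is the side of [x] after deletion of the edge between them. *)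
Definition branch t x : {set T} := [set z | connect (adj_minus t) x z].

Lemma adj_minus_sym t : symmetric (adj_minus t).
Proof. by move=> x y; rewrite /adj_minus /= adj_sym; congr andb; rewrite andbC. Qed.

Lemma path_adj_minus t x p :
  path (@adj T) x p -> t \notin x :: p -> path (adj_minus t) x p.
Proof.
rewrite /adj_minus; elim: p x => //= y p IHp x /andP[xy yp].
rewrite !inE !negb_or => /and3P[tx ty tp].
by rewrite xy eq_sym tx eq_sym ty IHp // inE negb_or ty.
Qed.

Lemma adj_minus_path t x p : x != t -> path (adj_minus t) x p ->
  path (@adj T) x p /\ t \notin x :: p.
Proof.
rewrite /adj_minus; elim: p x => [|y p IHp] x xt /=; first by rewrite inE eq_sym.
case/andP=> /and3P[-> _ yt] /(IHp _ yt)[-> tp].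
by rewrite inE negb_or eq_sym xt.
Qed.

Lemma branch_refl t x : x \in branch t x.
Proof. by rewrite inE. Qed.

Lemma branch_adj t x : adj x t -> t \notin branch t x.
Proof.
move=> xt; have nxt : x != t by apply: contraTneq xt => ->; rewrite adj_irr.
rewrite inE; apply/connectP=> -[p /(adj_minus_path nxt)[_ tp] e].
by rewrite e mem_last in tp.
Qed.

(* Two neighbours of [t] in one component of [T - t] would close a cycle. *)
Lemma branch_inj t x y : adj x t -> adj y t -> y \in branch t x -> x = y.
Proof.
move=> xt yt; rewrite inE => /connectP[p0 p0P e0].
have nxt : x != t by apply: contraTneq xt => ->; rewrite adj_irr.
case/shortenP: p0P e0 => p pP up _ ey; apply/eqP/negPn/negP=> nxy.
have [pA tp] := adj_minus_path nxt pP.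
have /(@tree_acyclic T) : ucycle (@adj T) (t :: x :: p).
  rewrite /ucycle /= (adj_sym t) xt rcons_path pA -ey yt /=.
  by move: tp up => /=; rewrite !inE => ->.
by case: p ey nxy {pP up pA tp} => //= ->; rewrite eqxx.
Qed.

Lemma branch_compl x y : adj x y -> branch y x = ~: branch x y.
Proof.
move=> xy; have nxy : x != y by apply: contraTneq xy => ->; rewrite adj_irr.
have nyx : y != x by rewrite eq_sym.
apply/setP=> z; rewrite 3!inE; apply/idP/idP => [xz|].
  apply/negP=> yz.
  (* [e] is adjacency without the edge from [x] to [y]. A node on both sides would give an [e]-path
     from [x] to [y], which that edge closes to a cycle. *)
  pose e := [rel a b : T | adj a b && ([set a; b] != [set x; y])].
  have es : symmetric e by move=> a b /=; rewrite adj_sym setUC.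
  have sub a b t : (t = x) \/ (t = y) -> connect (adj_minus t) a b -> connect e a b.
    move=> txy; apply: connect_sub => c d /= /and3P[cd ct dt].
    apply: connect1; rewrite /= cd; apply: contraNneq ct => ecd.
    have : t \in [set c; d] by rewrite ecd !inE; case: txy => ->; rewrite eqxx ?orbT.
    by rewrite !inE eq_sym => /orP[//|/eqP tE]; rewrite tE eqxx in dt.
  have : connect e x y.
    apply: connect_trans (sub _ _ y (or_intror erefl) xz) _.
    by rewrite (sym_connect_sym es); exact: sub (or_introl erefl) yz.
  case/connectP=> p0 p0P e0; case/shortenP: p0P e0 => p pP up _ ey.
  have /(@tree_acyclic T) : ucycle (@adj T) (x :: p).
    rewrite /ucycle up /= rcons_path -ey adj_sym xy !andbT.
    by apply: sub_path pP => a b /andP[].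
  case: p pP ey {up} => [|a [|b p]] //=; first by move=> _ e'; rewrite e' eqxx in nxy.
  by move=> + e'; rewrite -e' eqxx andbF.
move=> nyz; have /connectP[p0 p0P e0] := tree_connected x z.
case/shortenP: p0P e0 => p pP up _ ez.
have [yp|yp] := boolP (y \in x :: p); last first.
  by apply/connectP; exists p => //; apply: path_adj_minus pP yp.
rewrite inE (negPf nyx) /= in yp.
case/splitPr: yp pP up ez => p1 p2; rewrite cat_path last_cat /=.
move=> /and3P[_ _ p2P]; rewrite mem_cat inE negb_or => /andP[/andP[_ xp2] _] ez.
case/negP: nyz; apply/connectP; exists p2 => //.
by apply: path_adj_minus p2P _; rewrite inE negb_or nxy; move: xp2; rewrite negb_or => /andP[].
Qed.

Lemma components_branches t : components t = [set branch t x | x in [pred x | adj x t]].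
Proof.
have blockE z : z != t ->
    [set y in [set~ t] | connect (adj_minus t) z y] = branch t z.
  move=> zt; apply/setP=> y; rewrite !inE andbC.
  have [zy|//] := boolP (connect _ z y); apply/eqP=> yt; rewrite yt in zy.
  have /connectP[p /(adj_minus_path zt)[_ tp] e] := zy.
  by rewrite e mem_last in tp.
apply/setP=> C; apply/imsetP/imsetP => -[z]; last first.
  rewrite inE => zt ->; have nzt : z != t by apply: contraTneq zt => ->; rewrite adj_irr.
  by exists z; rewrite ?inE // blockE.
rewrite 2!inE => nzt ->; rewrite blockE //.
(* The last node before [t] on a simple path from [z] is the neighbour of [t] in the component of
   [z]. *)
have /connectP[p0 p0P e0] := tree_connected z t.
case/shortenP: p0P e0 => p pP up _ et.
case/lastP: p pP up et => [|q u]; first by move=> _ _ /= e; rewrite e eqxx in nzt.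
rewrite rcons_path last_rcons => /andP[qP qu] up eu; subst u.
exists (last z q); rewrite ?inE //; apply/setP=> y; rewrite !inE.
apply: same_connect; first exact/sym_connect_sym/adj_minus_sym.
apply/connectP; exists q => //; apply: path_adj_minus qP _.
by move: up; rewrite -rcons_cons rcons_uniq => /andP[].
Qed.

Lemma branches_disjoint t x y z : adj x t -> adj y t ->
  z \in branch t x -> z \in branch t y -> x = y.
Proof.
move=> xt yt; rewrite !inE => xz yz; apply: (branch_inj xt yt); rewrite inE.
by apply: connect_trans xz _; rewrite (sym_connect_sym (adj_minus_sym t)).
Qed.

(** Edges are treated from the leaves inwards: the branch behind an earlier edge is strictly
    smaller, as it misses [x]. *)
Lemma edge_induction (Q : T -> T -> Prop) :
    (forall x t, adj x t -> (forall y, adj y x -> y != t -> Q y x) -> Q x t) ->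
  forall x t, adj x t -> Q x t.
Proof.
move=> IH x t; have [n] := ubnP #|branch t x|; elim: n x t => // n IHn x t lt_n xt.
apply: (IH _ _ xt) => y yx nyt; apply: (IHn) (yx).
suff /proper_card h : branch x y \proper branch t x by exact: leq_trans h lt_n.
rewrite properE; apply/andP; split; last first.
  by apply: contra (branch_adj yx) => /subsetP; apply; apply: branch_refl.
rewrite (branch_compl xt); apply/subsetP=> z zy; rewrite inE; apply/negP=> zt.
by case/eqP: nyt; apply: (branches_disjoint yx _ zy zt); rewrite adj_sym.
Qed.

End Branches.

(** * Separation trees and tree-decompositions *)

Section TreeDecompositions.
Variables (E : finType) (M : matroid E) (k : int).

Lemma perm_enum_setD1 (I : finType) (X : {set I}) x :
  x \in X -> perm_eq (enum X) (x :: enum (X :\ x)).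
Proof.
move=> xX; apply: uniq_perm; rewrite /= ?enum_uniq ?mem_enum ?inE ?eqxx //.
by move=> y; rewrite inE !mem_enum !inE; case: eqVneq => // ->.
Qed.

Lemma separation_tree_derivable (T : tree) (alpha : T -> T -> sep E) :
  separation_tree M k alpha -> derivable M k set0 setT.
Proof.
move=> [sA inv st]; have /card_gt0P[t0 _] := tree_nonempty T.
have dQ : forall x t, adj x t -> derivable M k set0 (alpha x t).1.
  apply: edge_induction => x t xt IH.
  have xtS : alpha t x \in [set alpha y x | y in [pred y | adj y x]].
    by apply/imsetP; exists t; rewrite // inE adj_sym.
  (* In the star at [x], the separation from [t] supplies the inverse of the one being derived; the
     others are derived by induction. *)
  have := small_perm (perm_map _ (perm_enum_setD1 xtS)) (small_of_star (st x)).
  rewrite /=; have -> : (alpha t x).1 = ~: (alpha x t).1.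
    have := sA _ _ xt; rewrite inE in_bipartitions => /andP[/eqP<- _].
    by rewrite (inv _ _ xt).
  move=> sl; apply: derivable_star sl _ => _ /mapP[s + ->].
  rewrite mem_enum 2!inE => /andP[nst /imsetP[y]]; rewrite inE => yx e.
  by rewrite e; apply: IH => //; apply: contraNneq nst => yt; rewrite e yt.
apply: derivable_small (small_of_star (st t0)) _ => _ /mapP[s + ->].
by rewrite mem_enum => /imsetP[y + ->]; rewrite inE => /dQ.
Qed.

Lemma separation_tree_no_tangle (T : tree) (alpha : T -> T -> sep E) O :
  separation_tree M k alpha -> tangle M k O -> False.
Proof.
move=> [sA inv st] [[_ ori] _ nost]; have /card_gt0P[t0 _] := tree_nonempty T.
suff inO : forall x t, adj x t -> alpha x t \in O.
  apply: nost (st t0); apply/subsetP=> _ /imsetP[x + ->]; rewrite inE; exact: inO.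
apply: edge_induction => x t xt IH; apply/negPn/negP=> nO.
have /eqP/cards1P[s es] := ori _ (sA _ _ xt).
have /setIP[sO] : s \in O :&: [set alpha x t; sep_inv (alpha x t)] by rewrite es set11.
rewrite -inv // !inE => /orP[]/eqP se; first by rewrite -se sO in nO.
apply: nost (st x); apply/subsetP=> _ /imsetP[y + ->]; rewrite inE => yx.
by have [->|/(IH y yx)//] := eqVneq y t; rewrite -se.
Qed.

(* Ground elements exclude the degenerate separation [(set0, set0)]. *)
Lemma star_of_small (l : seq {set E}) (e0 : E) :
  small M k l -> small_star M k [set s in [seq (A, ~: A) | A <- l]].
Proof.
move=> [dl sl]; split.
- apply/subsetP=> s; rewrite inE => /mapP[A _ ->].
  by rewrite in_bipartitions.
- split=> [s|s t]; rewrite !inE => /mapP[A Al ->].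
    by case=> /setP/(_ e0); rewrite inE; case: (e0 \in A).
  move=> /mapP[B Bl ->] nAB; have nBA : B != A by apply/eqP=> e; apply: nAB; rewrite e.
  have := perm_to_rem Al => /permP p.
  have [] := @pairwise_disjoint_cons _ A (rem A l).
    by move=> e; rewrite -p; apply: dl.
  move=> _ /(_ B) sB; rewrite /sep_le /sep_inv /= -setCS setCK.
  suff -> : B \subset ~: A by [].
  apply: sB; have := perm_mem (perm_to_rem Al) B.
  by rewrite inE (negPf nBA) Bl /= => <-.
- apply: le_lt_trans sl; rewrite lerD2l.
  elim: l dl => [|A l IHl] dl; first by rewrite big_nil big_pred0 // => s; rewrite inE.
  have [/IHl le_l dA] := pairwise_disjoint_cons dl; rewrite big_cons.
  have -> : [set s in [seq (A, ~: A) | A <- A :: l]] =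
            (A, ~: A) |: [set s in [seq (A, ~: A) | A <- l]].
    by apply/setP=> s; rewrite !inE.
  (* Passing to a set removes repetitions; by disjointness only the empty side can repeat, and its
     term is 0. *)
  have [|nA] := boolP ((A, ~: A) \in [set s in [seq (A, ~: A) | A <- l]]); last first.
    by rewrite big_setU1 //= lerD2l.
  move=> hA; have : A \subset set0.
    move: hA; rewrite inE => /mapP[B Bl [eAB _]]; subst B.
    by rewrite -(setICr A) subsetI subxx dA.
  rewrite subset0 => /eqP A0; rewrite (setUidPr _) ?sub1set // A0 setC0.
  by rewrite /mrank subrr add0r.
Qed.

Section Width.
Variables (T : tree) (tau : E -> T).

Definition edge_set (x t : T) : {set E} := tau @^-1: branch t x.

Lemma edge_setC x t : adj x t -> edge_set t x = ~: edge_set x t.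
Proof. by move=> xt; rewrite /edge_set (branch_compl xt) preimsetC setCK. Qed.

(** Neighbours of [t] correspond to components of [T - t], so the width takes the form of a star
    order. *)
Lemma node_widthE t : node_width M tau t =
  mrank M + \sum_(x | adj x t) (rank M (~: edge_set x t) - mrank M).
Proof.
rewrite /node_width components_branches.
have inj : {in [pred x | adj x t] &, injective (branch t)}.
  by move=> x y; rewrite !inE => xt yt e; apply: (branch_inj xt yt);
     rewrite e branch_refl.
rewrite big_imset // card_in_imset // sumrB sumr_const /=.
rewrite -mulr_natl natz mulrBl mul1r.
rewrite (eq_bigl (fun x => adj x t)); last by move=> x; rewrite inE.
by rewrite opprB addrCA.
Qed.

Lemma small_edge_sets t : node_width M tau t < k ->
  small M k [seq edge_set x t | x <- enum [pred x | adj x t]].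
Proof.
move=> wt; split; last by rewrite big_map big_enum /= -node_widthE.
move=> e; rewrite count_map -size_filter -(card_uniqP _); last first.
  by rewrite filter_uniq ?enum_uniq.
apply/card_le1_eqP => x y; rewrite !(mem_filter _ _ (enum _)) !mem_enum !inE /=.
by move=> /andP[xe xt] /andP[ye yt]; apply: (@branches_disjoint _ t y x (tau e)); rewrite ?inE.
Qed.

Lemma separation_tree_of_decomposition (e0 : E) :
  (forall t, node_width M tau t < k) ->
  separation_tree M k (fun x t => (edge_set x t, ~: edge_set x t)).
Proof.
move=> wt; split=> [x t xt|x t xt|t].
(* The star at one end of an edge already bounds the order of the edge. *)
- rewrite sep_in_below; apply: small_connectivity (small_edge_sets (wt t)) _.
  by apply: map_f; rewrite mem_enum inE.
- by rewrite /sep_inv /= (edge_setC xt) setCK.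
have := star_of_small e0 (small_edge_sets (wt t)).
rewrite (_ : [set s in _] = [set (edge_set x t, ~: edge_set x t) | x in [pred x | adj x t]]) //.
apply/setP=> s; rewrite inE; apply/mapP/imsetP => [[A /mapP[x + ->] ->]|[x xt ->]].
  by rewrite mem_enum => xt; exists x.
by exists (edge_set x t) => //; apply: map_f; rewrite mem_enum.
Qed.

End Width.
End TreeDecompositions.

(** * Rooted trees *)

(** A rooted tree on [option F] with root [None], given by the parents of the
    other nodes. *)
Record rooted_tree := RootedTree {
  nonroot :> finType;
  parent : nonroot -> option nonroot;
  height : nonroot -> nat;
  height_parent : forall a b, parent a = Some b -> (height b < height a)%N
}.

Section RootedTree.
Variable F : rooted_tree.
Implicit Types x y z : option F.

Definition depth x : nat := if x is Some a then (height a).+1 else 0.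

Definition up : rel (option F) :=
  [rel x y | if x is Some a then parent a == y else false].

Definition rooted_adj : rel (option F) := [rel x y | up x y || up y x].

Lemma up_depth x y : up x y -> (depth y < depth x)%N.
Proof. by case: x => //= a /eqP; case: y => //= b /height_parent. Qed.

Lemma up_fun x y z : up x y -> up x z -> y = z.
Proof. by case: x => [a|//] /eqP<- /eqP. Qed.

Lemma up_depth_connect x y : connect up x y -> (depth y <= depth x)%N.
Proof.
case/connectP=> p + ->; elim: p x => //= y' p IHp x /andP[/up_depth xy' /IHp].
by move/leq_trans; apply; apply: ltnW.
Qed.

Lemma up_root x : connect up x None.
Proof.
have [n] := ubnP (depth x); elim: n x => // n IHn [a|] // lt_n.
apply: connect_trans (connect1 (_ : up _ (parent a))) (IHn _ _) => /=; first exact: eqxx.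
exact: leq_trans (@up_depth (Some a) (parent a) (eqxx _)) lt_n.
Qed.

Lemma rooted_adj_sym : symmetric rooted_adj.
Proof. by move=> x y; apply: orbC. Qed.

Lemma rooted_adj_irr : irreflexive rooted_adj.
Proof.
by move=> x; apply/negP=> /orP[]/up_depth; rewrite ltnn.
Qed.

Lemma rooted_nonempty : (0 < #|{: option F}|)%N.
Proof. by rewrite card_option. Qed.

Lemma rooted_connected x y : connect rooted_adj x y.
Proof.
have h z : connect rooted_adj z None.
  by apply: (connect_sub _ (up_root z)) => a b ab; apply/connect1/orP; left.
by apply: connect_trans (h x) _; rewrite (sym_connect_sym rooted_adj_sym).
Qed.

(* Both neighbours of a deepest node of a cycle are its parent. *)
Lemma rooted_acyclic (c : seq (option F)) : ucycle rooted_adj c -> (size c < 3)%N.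
Proof.
case: c => // x0 c0 uc.
have [m mc maxm] : exists2 m, m \in x0 :: c0 &
    forall x, x \in x0 :: c0 -> (depth x <= depth m)%N.
  have h : [pred x in x0 :: c0] x0 by rewrite /= mem_head.
  by case: (arg_maxnP depth h) => m hm mx; exists m.
have [i p e] := rot_to mc.
have sz : size (x0 :: c0) = size (m :: p) by rewrite -e size_rot.
have maxp x : x \in m :: p -> (depth x <= depth m)%N by rewrite -e mem_rot => /maxm.
have : ucycle rooted_adj (m :: p) by rewrite -e rot_ucycle.
rewrite sz {x0 c0 i uc mc e sz maxm}; case: p maxp => // a p maxp /andP[cyc un].
have parent_m x : x \in m :: a :: p -> rooted_adj m x -> up m x.
  by move=> /maxp le_x /orP[//|/up_depth]; rewrite ltnNge le_x.
move: cyc; rewrite /= rcons_path => /and3P[ma _].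
rewrite -/(rooted_adj _ _) rooted_adj_sym => mb.
have mup : up m (last a p) by apply: parent_m mb; rewrite inE mem_last orbT.
have mua : up m a by apply: parent_m ma; rewrite !inE eqxx orbT.
have eab := up_fun mua mup.
case: p un eab {maxp parent_m ma mb mup} => // b p /and3P[_ ap _] /= eab.
by rewrite {1}eab mem_last in ap.
Qed.

Definition tree_of_rooted : tree :=
  Tree rooted_adj_sym rooted_adj_irr rooted_nonempty rooted_connected rooted_acyclic.

(** A walk from [a] can leave the descendants of [a] only by the step to [parent a], which is
    excluded. Conversely, the upward chain to [a] stays among descendants, none of which is
    [parent a] by depth. *)
Lemma branch_up (a : F) x :
  (x \in @branch tree_of_rooted (parent a) (Some a)) = connect up x (Some a).
Proof.
have pa z : connect up z (Some a) -> z != parent a.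
  move/up_depth_connect => le_z; apply: contraTneq le_z => ->.
  by rewrite -ltnNge; exact: (@up_depth (Some a) (parent a) (eqxx _)).
rewrite inE; apply/idP/idP=> [|xa].
  case/connectP=> p + ->; move: (connect0 up (Some a)).
  elim: p {1 3 4}(Some a) => //= z p IHp y ya /andP[/and3P[yz _ zp] pP].
  apply: IHp pP; case/orP: yz => [yz|zy]; last exact: connect_trans (connect1 zy) ya.
  case/connectP: ya => -[_ /= e|w q /= /andP[yw wq] e].
    by move: yz zp; rewrite -e /= => /eqP->; rewrite eqxx.
  by apply/connectP; exists q; rewrite // (up_fun yz yw).
have /sym_connect_sym -> := @adj_minus_sym tree_of_rooted (parent a).
case/connectP: xa => p; elim: p x => [x _ ->|y p IHp x] //.
rewrite [path _ _ _]/= [last _ _]/= => /andP[xy pP] e.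
have ya : connect up y (Some a) by apply/connectP; exists p.
apply: connect_trans (IHp _ pP e); apply: connect1; apply/and3P; split.
- by apply/orP; left.
- exact/pa/(connect_trans (connect1 xy) ya).
- exact: pa ya.
Qed.

End RootedTree.

(** * Assembling a derivation into a rooted tree *)

Section Branching.
Variables (E : finType) (M : matroid E) (k : int).

(** [S x] is the set of the elements placed at or below [x]; the first member of
    the star at [x] belongs to the edge towards the root. *)
Definition branching (F : rooted_tree) (S : option F -> {set E}) : Prop :=
  forall x, small M k (~: S x :: [seq S (Some a) | a <- enum [pred a | parent a == x]]).

Section Join.
Variables (n : nat) (F : 'I_n -> rooted_tree).

(** The trees [F i] are hung below a new root: the old root of each becomes a child of it. *)
Definition join_parent (p : {i : 'I_n & option (F i)}) :
    option {i : 'I_n & option (F i)} :=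
  if tagged p is Some a then Some (Tagged (fun i => option (F i)) (parent a))
  else None.

Lemma join_height p q :
  join_parent p = Some q -> (depth (tagged q) < depth (tagged p))%N.
Proof.
case: p => i [a|] //= [<-] /=; exact: (@up_depth _ (Some a) _ (eqxx _)).
Qed.

Definition join : rooted_tree := RootedTree join_height.

Lemma join_branching (A : {set E}) (S : forall i, option (F i) -> {set E}) :
    small M k (~: A :: [seq S i None | i <- enum 'I_n]) ->
    (forall i, branching (S i)) ->
  @branching join (fun x => if x is Some p then S (tag p) (tagged p) else A).
Proof.
pose Fn i := option (F i).
move=> sA bS [[j o]|]; last first.
  apply: small_perm sA; rewrite perm_cons perm_sym.
  rewrite (map_comp (fun p : join => S (tag p) (tagged p))
     (fun i : 'I_n => Tagged Fn (None : Fn i))) //.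
  apply: perm_map; apply: uniq_perm; rewrite ?enum_uniq //.
    by rewrite map_inj_uniq ?enum_uniq // => i j [].
  move=> p; rewrite mem_enum inE /=.
  apply/eqP/mapP => [|[i _ ->]] //; case: p => i [//|] _.
  by exists i; rewrite ?mem_enum.
apply: small_perm (bS j o); rewrite perm_cons perm_sym.
rewrite (map_comp (fun p : join => S (tag p) (tagged p))
     (fun a : F j => Tagged Fn (Some a : Fn j))) //.
apply: perm_map; apply: uniq_perm; rewrite ?enum_uniq //.
  by rewrite map_inj_uniq ?enum_uniq // => a b /eqP; rewrite eq_Tagged => /eqP[].
move=> p; rewrite mem_enum inE /=.
apply/eqP/mapP => [|[a]]; last by rewrite mem_enum inE => /eqP ea ->; rewrite /= -ea.
case: p => i [a|//] [ei]; subst i => /eqP; rewrite eq_Tagged /= => /eqP ea.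
by exists a; rewrite ?mem_enum ?inE ?ea.
Qed.

End Join.

Lemma derivable_branching A : derivable M k set0 A ->
  exists (F : rooted_tree) (S : option F -> {set E}), branching S /\ S None = A.
Proof.
elim=> {A} [A|A l sl _ IH]; first by rewrite inE.
(* Indexing by positions gives each repeated member of [l] its own subtree. *)
have h (i : 'I_(size l)) : exists FS : {F : rooted_tree & option F -> {set E}},
    branching (projT2 FS) /\ projT2 FS None = tnth (in_tuple l) i.
  by have [F [S FS]] := IH _ (mem_tnth i (in_tuple l)); exists (existT _ F S).
pose FS i := proj1_sig (constructive_indefinite_description _ (h i)).
have FSP i : branching (projT2 (FS i)) /\ projT2 (FS i) None = tnth (in_tuple l) i.
  exact: proj2_sig (constructive_indefinite_description _ (h i)).
exists (join (fun i => projT1 (FS i))).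
exists (fun x => if x is Some p then projT2 (FS (tag p)) (tagged p) else A).
split=> //; apply: (@join_branching _ _ A (fun i => projT2 (FS i))) => [|i]; last by case: (FSP i).
rewrite (eq_map (g := tnth (in_tuple l))) ?map_tnth_enum // => i.
by case: (FSP i).
Qed.

(** * From a rooted tree of stars to a tree-decomposition *)

Section Decomposition.
Variables (F : rooted_tree) (S : option F -> {set E}).
Hypotheses (bS : branching S) (S0 : S None = setT).

Lemma branching_sub (a : F) : S (Some a) \subset S (parent a).
Proof.
have [/pairwise_disjoint_cons[_ h] _] := bS (parent a).
by rewrite -(setCK (S (parent a))); apply/h/map_f; rewrite mem_enum inE.
Qed.

Lemma branching_up x y : connect (@up F) x y -> S x \subset S y.
Proof.
case/connectP=> p + ->; elim: p x => //= z p IHp [a|] //= /andP[/eqP<- /IHp].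
exact/subset_trans/branching_sub.
Qed.

Lemma branching_disjoint (a b : F) e : parent a = parent b ->
  e \in S (Some a) -> e \in S (Some b) -> a = b.
Proof.
move=> pab ea eb; have [/pairwise_disjoint_cons[/(_ e) + _] _] := bS (parent b).
rewrite count_map -size_filter -(card_uniqP _); last first.
  by rewrite filter_uniq ?enum_uniq.
move/card_le1_eqP; apply; rewrite (mem_filter _ _ (enum _)) mem_enum.
  by apply/andP; split=> //; apply: eqxx.
by apply/andP; split=> //; apply/eqP.
Qed.

Definition lowest e x : Prop :=
  e \in S x /\ forall a : F, e \in S (Some a) -> parent a != x.

Lemma lowest_exists e : exists x, lowest e x.
Proof.
have h : [pred x | e \in S x] None by rewrite /= S0 inE.
case: (arg_maxnP (@depth F) h) => x /= ex mx; exists x; split=> // a ea.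
apply/negP=> pa; have := mx _ ea; rewrite leqNgt => /negP; apply.
exact: (@up_depth F (Some a) x pa).
Qed.

(** The nodes whose sets contain [e] form a chain. By induction [x] is at or below the parent of
    [y], and not equal to it as [x] is lowest; the child of that parent above [x] contains [e], so
    by disjointness of siblings it is [y]. *)
Lemma lowest_up e x y : lowest e x -> e \in S y -> connect (@up F) x y.
Proof.
move=> [ex lx]; have [n] := ubnP (depth y); elim: n y => // n IHn [a|] lt_n ey.
  have up_a : up (Some a) (parent a) by apply: eqxx.
  have epa : e \in S (parent a) by apply: subsetP ey; apply: branching_sub.
  have /connectP[p pP ep] := IHn _ (leq_trans (up_depth up_a) lt_n) epa.
  case/lastP: p pP ep => [_ e0|p z].
    by have := lx _ ey; rewrite e0 eqxx.
  rewrite rcons_path last_rcons => /andP[pP zP] ez; subst z.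
  have xp : connect (@up F) x (last x p) by apply/connectP; exists p.
  case: (last x p) zP xp => //= b /eqP eab xb.
  have eb : e \in S (Some b) by apply: subsetP ex; apply: branching_up.
  by rewrite (branching_disjoint (esym eab) ey eb).
exact: up_root.
Qed.

Lemma branching_decomposition :
  exists tau : E -> tree_of_rooted F, forall t, node_width M tau t < k.
Proof.
pose tau e := proj1_sig (constructive_indefinite_description _ (lowest_exists e)).
have tauP e : lowest e (tau e).
  exact: proj2_sig (constructive_indefinite_description _ (lowest_exists e)).
exists (tau : E -> tree_of_rooted F) => t.
(* Hence the edge from a child to its parent induces the set of the child, and the star at [t]
   bounds the width. *)
have childE (a : F) : edge_set (T := tree_of_rooted F) tau (Some a) (parent a) = S (Some a).
  apply/setP=> e; rewrite inE branch_up; apply/idP/idP=> [h|].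
    by apply: subsetP (branching_up h) _ _; case: (tauP e).
  exact: lowest_up (tauP e).
rewrite node_widthE; have [_] := bS t; rewrite big_cons big_map big_enum setCK /=.
apply: le_lt_trans; rewrite lerD2l.
rewrite (bigID (fun x => up x t)) /= addrC lerD //.
  rewrite (eq_bigl (up t)) => [|x]; last first.
    apply/andP/idP => [[/orP[->//|//]]|tx]; split; first by apply/orP; right.
    by apply/negP=> /up_depth; rewrite ltnNge ltnW // up_depth.
  (* The root has no parent, and its term for [S None = setT] vanishes. *)
  case: t => [b|]; last by rewrite big_pred0 // S0 subrr.
  rewrite (big_pred1 (parent b)) => [|x]; last by rewrite /= eq_sym.
  rewrite (@edge_setC _ (tree_of_rooted F) tau (Some b) (parent b)) ?childE ?setCK //.
  by apply/orP; left; apply: eqxx.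
rewrite (reindex_omap Some id) => [|[a|]] //=; last by move=> /andP[_].
rewrite (eq_bigl [pred a | parent a == t]) => [|a]; last first.
  apply/andP/idP => [[/andP[]]//|ta]; split; last exact: eqxx.
  by apply/andP; split; first by apply/orP; left.
by rewrite le_eqVlt; apply/orP; left; apply/eqP/eq_bigr => a /eqP <-; rewrite childE.
Qed.

End Decomposition.
End Branching.

(** * The duality theorem *)

Lemma derivable_decomposition (E : finType) (M : matroid E) (k : int) :
  derivable M k set0 setT ->
  exists (T : tree) (tau : E -> T), forall t, node_width M tau t < k.
Proof.
move=> /derivable_branching[F [S [bS S0]]].
by exists (tree_of_rooted F); apply: branching_decomposition bS S0.
Qed.

Definition one_node : tree :=
  @tree_of_rooted (@RootedTree void (of_void _) (of_void _)
    (fun a => match a with end)).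

Lemma one_node_adj (x y : one_node) : adj x y = false.
Proof. by case: x y => [[]|] [[]|]. Qed.

(** On an empty ground set the only separation is its own inverse and so lies in no star; a single
    node with the empty star, of order 0, serves instead. *)
Lemma separation_tree_exists (E : finType) (M : matroid E) (k : int)
    (T : tree) (tau : E -> T) :
  0 < k -> (forall t, node_width M tau t < k) ->
  exists (T' : tree) (alpha : T' -> T' -> sep E), separation_tree M k alpha.
Proof.
move=> k_gt0 wt.
have [e0 _|E0] := pickP (@predT E).
  by exists T; eexists; apply: separation_tree_of_decomposition e0 wt.
exists one_node, (fun _ _ => (set0, set0)); split=> [x y|x y|t]; rewrite ?one_node_adj //.
rewrite (_ : [set _ | _ in _] = set0); last first.
  apply/setP=> s; rewrite in_set0; apply/negP=> /imsetP[x].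
  by rewrite inE one_node_adj.
split; first exact: sub0set.
  by split=> s; rewrite inE.
rewrite /star_order big_set0 addr0 /mrank (_ : [set: E] = set0) ?rank0 //.
by apply/setP=> e; have := E0 e.
Qed.

Lemma width_exists (E : finType) (M : matroid E) (T : tree) (tau : E -> T) :
  exists w, is_width M tau w.
Proof.
have /card_gt0P[t0 _] := tree_nonempty T.
have h : [pred x : T | true] t0 by [].
case: (arg_maxP (node_width M tau) h) => t _ mt; exists (node_width M tau t).
by split; [exists t | move=> t'; apply: mt].
Qed.

Lemma least_int (W : int -> Prop) (k : int) :
  (exists w, W w) -> (forall w, W w -> k <= w) ->
  exists2 w, W w & forall w', W w' -> w <= w'.
Proof.
move=> [w Ww] leW; have [n] := ubnP `|w - k|%N; elim: n w Ww => // n IHn w Ww lt_n.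
have [[w' [Ww' lt_w]]|nw] := classic (exists w', W w' /\ w' < w).
  by apply: (IHn w' Ww'); have := leW _ Ww'; move: lt_n lt_w; clear; lia.
exists w => // w' Ww'; rewrite leNgt; apply/negP=> lt_w; apply: nw; by exists w'.
Qed.

Theorem theorem8p5 (E : finType) (M : matroid E) (k : int) (k_gt0 : 0 < k) :
  [<-> exists2 w : int, is_tree_width M w & k <= w;
       ~ exists (T : tree) (alpha : T -> T -> sep E),
           separation_tree M k alpha;
       exists O : {set sep E}, tangle M k O].
Proof.
tfae.
- move=> [w [_ minw] le_kw] [T [alpha /separation_tree_derivable d]].
  have [T' [tau wt]] := derivable_decomposition d.
  have [w' ww'] := width_exists M tau; have le_ww' := minw _ _ _ ww'.
  have [[t et] _] := ww'; have := wt t.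
  by rewrite et ltNge (le_trans le_kw le_ww').
- move=> nT; apply: (tangle_exists k_gt0) => d; apply: nT.
  have [T [tau wt]] := derivable_decomposition d.
  exact: separation_tree_exists k_gt0 wt.
- move=> [O tO].
  have le_k w : (exists (T : tree) (tau : E -> T), is_width M tau w) -> k <= w.
    move=> [T [tau [_ maxw]]]; rewrite leNgt; apply/negP=> lt_wk.
    have wt t : node_width M tau t < k := le_lt_trans (maxw t) lt_wk.
    have [T' [alpha sT]] := separation_tree_exists k_gt0 wt.
    exact: separation_tree_no_tangle sT tO.
  (* The one-node decomposition supplies a width; as all widths are at least [k], a least one
     exists. *)
  have ex : exists w (T : tree) (tau : E -> T), is_width M tau w.
    have [w ww] := width_exists M (fun _ : E => None : one_node).
    by exists w, one_node, (fun _ => None).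
  have [w Ww minw] := least_int ex le_k.
  exists w; last exact: le_k.
  by split=> // T tau w' ww'; apply: minw; exists T, tau.
Qed.
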